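(* Let $R$ be a commutative ring with unit containing $\mathbb{Q}$, $n\ge 1$, and let $G=(G_i)_{1\le i\le n}$ be a system of formal power series with coefficients in $R$ in $n$ indeterminates $u=(u_1,\ldots,u_n)$. Let $F=(F_i)_{1\le i\le n}$ be the system of formal power series in $R[[X_1,\ldots,X_n]]$, without constant term, implicitly defined by $F_i=X_iG_i(F)$ for $1\le i\le n$. Let $$Z=\int d\bar u\,du\ e^{-\bar uu}\ e^{\bar uXG(u)}\in R[[X_1,\ldots,X_n]]$$ be the formal Gaussian integral with identity covariance. Then $$Z=\frac{1}{\det\left(I-X\partial G(F)\right)}.$$
   Context: $I$ is the $n\times n$ identity matrix and $X\partial G(F)$ is the $n\times n$ matrix over $R[[X_1,\ldots,X_n]]$ with entries $[X\partial G(F)]_{ij}=X_i\,\partial_jG_i(F)$, where $\partial_jG_i(F)$ is the result of substituting $F=F(X)$ for $u$ in $\frac{\partial G_i}{\partial u_j}(u)$. $\bar u=(\bar u_1,\ldots,\bar u_n)$ and $u$ are vectors of indeterminates and $\bar uXG(u)=\sum_{i=1}^n\bar u_iX_iG_i(u)$. Formal Gaussian integral with identity covariance: write $[k]=\{1,\ldots,k\}$. For $\alpha_1,\alpha_2\in\mathbb N^n$, $\int d\bar u\,du\ e^{-\bar uu}\ \bar u^{\alpha_1}u^{\alpha_2}=\sum_\sigma\prod_{k=1}^{k_1}\delta_{\tau_2(\sigma(k))\,\tau_1(k)}$, where $k_r=|\alpha_r|$, $\tau_r:[k_r]\to[n]$ is any map taking each value $i$ exactly $(\alpha_r)_i$ times,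 $\delta$ is Kronecker's symbol, and the sum is over all bijections $\sigma:[k_1]\to[k_2]$ (zero if $k_1\neq k_2$). For $U\in R[[\bar u,u,X]]$ the integral is the sum, over all monomials $\bar u^{\alpha_1}u^{\alpha_2}X^{\alpha_3}$, of the coefficient of the monomial in $U$ times $X^{\alpha_3}$ times the integral of $\bar u^{\alpha_1}u^{\alpha_2}$, an element of $R[[X]]$, defined whenever for each $\alpha_3$ only finitely many $(\alpha_1,\alpha_2)$ contribute nonzero terms. *)

(* Defs.v *)
From HB Require Import structures.
From mathcomp Require Import all_boot all_order all_algebra.
From mathcomp Require Import boolp classical_sets functions cardinality fsbigop.
From mathcomp Require Import mpoly.

Set Implicit Arguments.
Unset Strict Implicit.
Unset Printing Implicit Defensive.

Import GRing.Theory.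
Local Open Scope ring_scope.

(* Formal power series in n commuting indeterminates over R, as families of
   coefficients; f m is the coefficient of the monomial m in f. *)
Record mps (n : nat) (R : Type) : Type := MPS { mps_coef :> 'X_{1..n} -> R }.

Notation "{ 'mps' R [ n ] }" := (mps n R)
  (at level 0, R, n at level 2, format "{ 'mps'  R [ n ] }") : type_scope.

Lemma mpsP (n : nat) (R : Type) (f g : {mps R[n]}) : (f =1 g) <-> (f = g).
Proof. by split=> [|->//]; case: f g => [f] [g] /= /funext ->. Qed.

HB.instance Definition _ (n : nat) (R : Type) := gen_eqMixin {mps R[n]}.
HB.instance Definition _ (n : nat) (R : Type) := gen_choiceMixin {mps R[n]}.

Section Ring.
Variables (n : nat) (R : comNzRingType).
Implicit Types (f g h : {mps R[n]}) (m : 'X_{1..n}).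

Definition mps_zero : {mps R[n]} := MPS (fun=> 0).
Definition mps_add f g : {mps R[n]} := MPS (fun m => f m + g m).
Definition mps_opp f : {mps R[n]} := MPS (fun m => - f m).

Lemma mps_addA : associative mps_add.
Proof. by move=> f g h; apply/mpsP => m /=; rewrite addrA. Qed.
Lemma mps_addC : commutative mps_add.
Proof. by move=> f g; apply/mpsP => m /=; rewrite addrC. Qed.
Lemma mps_add0 : left_id mps_zero mps_add.
Proof. by move=> f; apply/mpsP => m /=; rewrite add0r. Qed.
Lemma mps_addN : left_inverse mps_zero mps_opp mps_add.
Proof. by move=> f; apply/mpsP => m /=; rewrite addNr. Qed.

HB.instance Definition _ :=
  GRing.isZmodule.Build {mps R[n]} mps_addA mps_addC mps_add0 mps_addN.

Definition mps_one : {mps R[n]} := MPS (fun m => (m == 0%MM)%:R).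

(* The bound on the degrees of k.1 and k.2 only makes the index type finite:
   it is implied by m = k.1 + k.2. *)
Definition mps_mul f g : {mps R[n]} := MPS (fun m =>
  \sum_(k : 'X_{1..n < (mdeg m).+1, (mdeg m).+1} | m == (k.1 + k.2)%MM)
     f k.1 * g k.2).

Definition mps_trunc (d : nat) f : {mpoly R[n]} :=
  \sum_(m : 'X_{1..n < d}) f m *: 'X_[m].

Lemma mcoeff_trunc d f m : (mps_trunc d f)@_m = if (mdeg m < d)%N then f m else 0.
Proof.
rewrite /mps_trunc raddf_sum /=; case: ltnP => [lt_md | le_dm].
  rewrite (bigD1 (BMultinom lt_md)) //= mcoeffZ mcoeffX eqxx mulr1 big1 ?addr0 //.
  move=> k /eqP nek; rewrite mcoeffZ mcoeffX; case: eqP => [eqk|]; last by rewrite mulr0.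
  by case: nek; apply/val_inj.
rewrite big1 // => k _; rewrite mcoeffZ mcoeffX; case: eqP => [eqk|]; last by rewrite mulr0.
by have := bmdeg k; rewrite eqk ltnNge le_dm.
Qed.

Lemma eq_mcoeffM (p p' q q' : {mpoly R[n]}) m :
    (forall k, (mdeg k <= mdeg m)%N -> p@_k = p'@_k) ->
    (forall k, (mdeg k <= mdeg m)%N -> q@_k = q'@_k) ->
  (p * q)@_m = (p' * q')@_m.
Proof.
move=> eqp eqq; rewrite !mcoeffM; apply: eq_bigr => k _.
by congr (_ * _); [apply: eqp | apply: eqq]; rewrite -ltnS; apply: bmdeg.
Qed.

Lemma mps_mulE d f g m : (mdeg m < d)%N ->
  mps_mul f g m = (mps_trunc d f * mps_trunc d g)@_m.
Proof.
move=> lt_md; rewrite mcoeffM /=; apply: eq_bigr => k _.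
by rewrite !mcoeff_trunc !(leq_ltn_trans _ lt_md) // -ltnS bmdeg.
Qed.

Lemma mps_truncM d f g m : (mdeg m < d)%N ->
  (mps_trunc d (mps_mul f g))@_m = (mps_trunc d f * mps_trunc d g)@_m.
Proof. by move=> lt_md; rewrite mcoeff_trunc lt_md (mps_mulE _ _ lt_md). Qed.

Lemma mps_mulA : associative mps_mul.
Proof.
move=> f g h; apply/mpsP => m; rewrite !(mps_mulE _ _ (ltnSn (mdeg m))).
have -> : (mps_trunc (mdeg m).+1 f * mps_trunc (mdeg m).+1 (mps_mul g h))@_m
   = (mps_trunc (mdeg m).+1 f * (mps_trunc (mdeg m).+1 g * mps_trunc (mdeg m).+1 h))@_m.
  by apply: eq_mcoeffM => // k le_km; rewrite mps_truncM.
by rewrite mulrA; apply: eq_mcoeffM => // k le_km; rewrite mps_truncM.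
Qed.

Lemma mps_mulC : commutative mps_mul.
Proof.
by move=> f g; apply/mpsP => m; rewrite !(mps_mulE _ _ (ltnSn (mdeg m))) mulrC.
Qed.

Lemma mps_mul1 : left_id mps_one mps_mul.
Proof.
move=> f; apply/mpsP => m; rewrite (mps_mulE _ _ (ltnSn (mdeg m))).
have -> : mps_trunc (mdeg m).+1 mps_one = 1.
  apply/mpolyP => k; rewrite mcoeff_trunc mcoeff1 /=; case: ltnP => //.
  by case: eqP => // ->; rewrite mdeg0.
by rewrite mul1r mcoeff_trunc ltnSn.
Qed.

Lemma mps_mulDl : left_distributive mps_mul mps_add.
Proof.
move=> f g h; apply/mpsP => m /=; rewrite -big_split; apply: eq_bigr => k _ /=.
by rewrite mulrDl.
Qed.

Lemma mps_one_neq0 : mps_one != 0.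
Proof.
by apply/eqP => /mpsP /(_ 0%MM) /=; rewrite eqxx; apply/eqP/oner_neq0.
Qed.

HB.instance Definition _ := GRing.Zmodule_isComNzRing.Build {mps R[n]}
  mps_mulA mps_mulC mps_mul1 mps_mulDl mps_one_neq0.

Definition mps_scale (c : R) f : {mps R[n]} := MPS (fun m => c * f m).

Lemma mps_scaleA (a b : R) f : mps_scale a (mps_scale b f) = mps_scale (a * b) f.
Proof. by apply/mpsP => m /=; rewrite mulrA. Qed.
Lemma mps_scale1 : left_id 1 mps_scale.
Proof. by move=> f; apply/mpsP => m /=; rewrite mul1r. Qed.
Lemma mps_scaleDr : right_distributive mps_scale +%R.
Proof. by move=> a f g; apply/mpsP => m /=; rewrite mulrDr. Qed.
Lemma mps_scaleDl f : {morph mps_scale^~ f : a b / a + b}.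
Proof. by move=> a b; apply/mpsP => m /=; rewrite mulrDl. Qed.

HB.instance Definition _ := GRing.Zmodule_isLmodule.Build R {mps R[n]}
  mps_scaleA mps_scale1 mps_scaleDr mps_scaleDl.

Lemma mps_scaleAl (a : R) f g : a *: (f * g) = (a *: f) * g.
Proof.
apply/mpsP => m /=; rewrite mulr_sumr; apply: eq_bigr => k _ /=.
by rewrite mulrA.
Qed.

HB.instance Definition _ := GRing.Lmodule_isLalgebra.Build R {mps R[n]} mps_scaleAl.
HB.instance Definition _ := GRing.Lalgebra_isComAlgebra.Build R {mps R[n]}.

Definition mps_unit : pred {mps R[n]} := fun f => `[< exists g, g * f = 1 >].

Definition mps_inv f : {mps R[n]} :=
  if pselect (exists g, g * f = 1) is left e then projT1 (cid e) else f.

Lemma mps_mulV : {in mps_unit, left_inverse 1 mps_inv *%R}.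
Proof.
move=> f /asboolP fU; rewrite /mps_inv; case: pselect => // e.
exact: projT2 (cid e).
Qed.

Lemma mps_unitP f g : g * f = 1 -> mps_unit f.
Proof. by move=> gf1; apply/asboolP; exists g. Qed.

Lemma mps_inv_out : {in [predC mps_unit], mps_inv =1 id}.
Proof.
move=> f /asboolP nfU; rewrite /mps_inv; case: pselect => // e.
Qed.

HB.instance Definition _ := GRing.ComNzRing_hasMulInverse.Build {mps R[n]}
  mps_mulV mps_unitP mps_inv_out.

Lemma mps_coef0 m : (0 : {mps R[n]}) m = 0. Proof. by []. Qed.
Lemma mps_coefD f g m : (f + g) m = f m + g m. Proof. by []. Qed.
Lemma mps_coefN f m : (- f) m = - f m. Proof. by []. Qed.
Lemma mps_coefZ (c : R) f m : (c *: f) m = c * f m. Proof. by []. Qed.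
Lemma mps_coef1 m : (1 : {mps R[n]}) m = (m == 0%MM)%:R. Proof. by []. Qed.
Lemma mps_coefM f g m : (f * g) m =
  \sum_(k : 'X_{1..n < (mdeg m).+1, (mdeg m).+1} | m == (k.1 + k.2)%MM)
     f k.1 * g k.2.
Proof. by []. Qed.

End Ring.

Section Operations.
Variable R : comNzRingType.

Definition mpsXm (n : nat) (a : 'X_{1..n}) : {mps R[n]} := MPS (fun m => (m == a)%:R).
Definition mpsX (n : nat) (i : 'I_n) : {mps R[n]} := mpsXm U_(i)%MM.

(* Infinite formal sums: the family is summable when every monomial receives
   finitely many nonzero contributions.  mps_sum is meant for summable families
   only; otherwise the offending coefficients are set to 0 by convention. *)
Definition mps_summable (n : nat) (T : choiceType) (f : T -> {mps R[n]}) : Prop :=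
  forall m, finite_set [set t | f t m != 0].
Definition mps_sum (n : nat) (T : choiceType) (f : T -> {mps R[n]}) : {mps R[n]} :=
  MPS (fun m => \sum_(t \in [set: T]) f t m).

(* The substitution g(f_0, ..., f_(k-1)). *)
Definition comp_term (n k : nat) (g : {mps R[k]}) (f : 'I_k -> {mps R[n]})
    (a : 'X_{1..k}) : {mps R[n]} :=
  g a *: \prod_(i < k) f i ^+ a i.
Definition mps_comp (n k : nat) (g : {mps R[k]}) (f : 'I_k -> {mps R[n]}) : {mps R[n]} :=
  mps_sum (comp_term g f).

Definition mps_deriv (n : nat) (j : 'I_n) (f : {mps R[n]}) : {mps R[n]} :=
  MPS (fun m => f (m + U_(j))%MM *+ (m j).+1).

(* f has only terms of degree at least d *)
Definition mps_order_ge (n d : nat) (f : {mps R[n]}) : Prop :=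
  forall m, (mdeg m < d)%N -> f m = 0.

Lemma mps_order1 n : mps_order_ge 0 (1 : {mps R[n]}).
Proof. by []. Qed.

Lemma mps_orderM n d e (f g : {mps R[n]}) :
  mps_order_ge d f -> mps_order_ge e g -> mps_order_ge (d + e) (f * g).
Proof.
move=> fd ge m lt_m; rewrite mps_coefM big1 // => k /eqP Em.
have [/fd->|le1] := ltnP (mdeg k.1) d; first by rewrite mul0r.
have [/ge->|le2] := ltnP (mdeg k.2) e; first by rewrite mulr0.
by have := leq_add le1 le2; rewrite -mdegD -Em leqNgt lt_m.
Qed.

Lemma mps_orderX n (f : {mps R[n]}) k : f 0%MM = 0 -> mps_order_ge k (f ^+ k).
Proof.
move=> f0; elim: k => [|k IHk]; first by rewrite expr0; apply: mps_order1.
rewrite exprS -add1n; apply: mps_orderM => // m.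
by rewrite ltnS leqn0 mdeg_eq0 => /eqP ->.
Qed.

Lemma mps_orderZ n d c (f : {mps R[n]}) : mps_order_ge d f -> mps_order_ge d (c *: f).
Proof. by move=> fd m /fd; rewrite mps_coefZ => ->; rewrite mulr0. Qed.

Lemma mps_summable_order n (T : choiceType) (f : T -> {mps R[n]}) (d : T -> nat) :
    (forall t, mps_order_ge (d t) (f t)) ->
    (forall b, finite_set [set t | (d t <= b)%N]) ->
  mps_summable f.
Proof.
move=> fd dfin m; apply: sub_finite_set (dfin (mdeg m)) => t /=.
by apply: contraR; rewrite -ltnNge => /fd ->.
Qed.

Lemma comp_summable n k (g : {mps R[k]}) (f : 'I_k -> {mps R[n]}) :
  (forall i, f i 0%MM = 0) -> mps_summable (comp_term g f).
Proof.
move=> f0; apply: (@mps_summable_order _ _ _ (@mdeg k)) => [a | b].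
  apply: mps_orderZ; rewrite mdegE.
  apply: (big_ind2 (fun d h => mps_order_ge d h)); first exact: mps_order1.
    by move=> d h e h'; apply: mps_orderM.
  by move=> i _; apply: mps_orderX.
apply: (@sub_finite_set _ _ [set` [seq val x | x : 'X_{1..k < b.+1}]]).
  move=> a /= le_ab; have lt_ab : (mdeg a < b.+1)%N by rewrite ltnS.
  by apply/mapP; exists (BMultinom lt_ab); rewrite ?mem_enum.
exact: finite_seq.
Qed.

End Operations.

Section Exponential.
Variables (R : comAlgType rat) (n : nat).
Implicit Type f : {mps R[n]}.

Definition exp_term f (k : nat) : {mps R[n]} := (k`!%:R^-1 : rat)%:A *: f ^+ k.
Definition mps_exp f : {mps R[n]} := mps_sum (exp_term f).

Lemma exp_summable f : f 0%MM = 0 -> mps_summable (exp_term f).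
Proof.
move=> f0; apply: (@mps_summable_order _ _ _ _ id) => [k | b].
  by apply/mps_orderZ/mps_orderX.
apply: (@sub_finite_set _ _ [set` iota 0 b.+1]); last exact: finite_seq.
move=> k le_kb; suff: k \in iota 0 b.+1 by [].
by rewrite mem_iota add0n ltnS.
Qed.

End Exponential.

Section Gaussian.
Variables (R : comNzRingType) (n : nat).

(* The word listing each i exactly (a i) times; multi_idx a : [|a|] -> [n] is
   the associated indexing map. *)
Definition multi_word (a : 'X_{1..n}) : seq 'I_n :=
  flatten [seq nseq (a i) i | i <- enum 'I_n].

Lemma count_multi_word a i : count_mem i (multi_word a) = a i.
Proof.
rewrite /multi_word count_flatten -map_comp sumnE big_map big_enum /=.
rewrite (bigD1 i) //= count_nseq /= eqxx mul1n big1 ?addn0 // => j nej.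
by rewrite count_nseq /= (negPf nej).
Qed.

Lemma size_multi_word a : size (multi_word a) == mdeg a.
Proof.
rewrite /multi_word size_flatten /shape -map_comp sumnE big_map big_enum mdegE.
by apply/eqP/eq_bigr => i _ /=; rewrite size_nseq.
Qed.

Definition multi_idx (a : 'X_{1..n}) (k : 'I_(mdeg a)) : 'I_n :=
  tnth (Tuple (size_multi_word a)) k.

Lemma card_multi_idx a i : #|[set k | multi_idx (a := a) k == i]| = a i.
Proof.
transitivity (count_mem i (map (tnth (Tuple (size_multi_word a))) (enum 'I_(mdeg a)))).
  by rewrite count_map cardsE cardE [in LHS]/enum_mem size_filter enumT; apply: eq_count => k.
by rewrite (map_tnth_enum (Tuple (size_multi_word a))) count_multi_word.
Qed.

Definition is_bij (A B : finType) (s : {ffun A -> B}) : bool :=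
  injectiveb s && [forall y, y \in codom s].

Lemma is_bijP (A B : finType) (s : {ffun A -> B}) : reflect (bijective s) (is_bij s).
Proof.
apply: (iffP andP) => [[/injectiveP si /forallP sc] | bs].
  by apply: inj_card_bij => //; rewrite -(card_codom si); apply/subset_leq_card/fintype.subsetP => y _.
by split; [apply/injectiveP/bij_inj | apply/forallP => y; case: bs => t _ st; rewrite -[y]st codom_f].
Qed.

(* \int dubar du e^{-ubar u} ubar^a1 u^a2 *)
Definition gauss_moment (a1 a2 : 'X_{1..n}) : R :=
  \sum_(s : {ffun 'I_(mdeg a1) -> 'I_(mdeg a2)} | is_bij s)
     \prod_(k < mdeg a1) (multi_idx (s k) == multi_idx k)%:R.

(* Indeterminates of R[[ubar, u, X]], in this order. *)
Definition ubar_idx (i : 'I_n) : 'I_(n + n + n) := lshift n (lshift n i).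
Definition u_idx (i : 'I_n) : 'I_(n + n + n) := lshift n (rshift n i).
Definition X_idx (i : 'I_n) : 'I_(n + n + n) := rshift (n + n) i.

Definition ubar_part (m : 'X_{1..n + n + n}) : 'X_{1..n} := [multinom m (ubar_idx i) | i < n].
Definition u_part (m : 'X_{1..n + n + n}) : 'X_{1..n} := [multinom m (u_idx i) | i < n].
Definition X_part (m : 'X_{1..n + n + n}) : 'X_{1..n} := [multinom m (X_idx i) | i < n].

Definition gauss_term (U : {mps R[n + n + n]}) (m : 'X_{1..n + n + n}) : {mps R[n]} :=
  (U m * gauss_moment (ubar_part m) (u_part m)) *: mpsXm R (X_part m).

(* gauss_int U is \int dubar du e^{-ubar u} U, the Gaussian weight being part
   of the integral sign; it is defined when gauss_integrable U holds. *)
Definition gauss_integrable (U : {mps R[n + n + n]}) : Prop :=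
  mps_summable (gauss_term U).
Definition gauss_int (U : {mps R[n + n + n]}) : {mps R[n]} :=
  mps_sum (gauss_term U).

(* ubar X G(u) *)
Definition ubarXG (G : 'I_n -> {mps R[n]}) : {mps R[n + n + n]} :=
  \sum_(i < n) mpsX R (ubar_idx i) * mpsX R (X_idx i)
                 * mps_comp (G i) (fun j => mpsX R (u_idx j)).

(* X dG(F) *)
Definition XdG (G F : 'I_n -> {mps R[n]}) : 'M[{mps R[n]}]_n :=
  \matrix_(i, j) (mpsX R i * mps_comp (mps_deriv j (G i)) F).

End Gaussian.

(* Main.v *)
(* The moment of ubar^a u^b is a! if a = b and 0 otherwise, so Z is the sum over b of
   X^b [u^b] G^b = L 1, where L h := sum over b of X^b [u^b] (h G^b).  Since
   L (u_i h) = X_i L (G_i h), L kills the ideal of the u_i - X_i G_i(u), whence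
   L h = h(F) L 1.  Applying this to h = det (I - X dG(u)), it remains to see that
   [u^b] det (delta_ij G_i^b_i - u_j d_j G_i G_i^(b_i - 1)) = 0 for b <> 0: row i
   scaled by b_i is delta_ij b_i f_i - u_j d_j f_i with f_i = G_i^b_i, and on each
   monomial of degree b the rows of the resulting numerical matrix sum to 0. *)
Require Import Defs.
From HB Require Import structures.
From mathcomp Require Import all_boot all_order all_algebra all_fingroup.
From mathcomp Require Import boolp classical_sets functions cardinality fsbigop.
From mathcomp Require Import mpoly.

Set Implicit Arguments.
Unset Strict Implicit.
Unset Printing Implicit Defensive.

Import GRing.Theory Num.Theory.
Local Open Scope ring_scope.

(** Turns the coefficients of [mps_sum] into ordinary finite sums. *)
Lemma fsum_seq (T : choiceType) (V : nmodType) (s : seq T) (F : T -> V) :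
    uniq s -> (forall x, x \notin s -> F x = 0) ->
  \sum_(x \in [set: T]%classic) F x = \sum_(x <- s) F x.
Proof.
move=> us F0; apply/esym; have F0' x : predT x -> x \notin s -> F x = 0 by move=> _ /F0.
by rewrite (bigfs +%R us F0'); apply/eq_fsbigl/seteqP; split.
Qed.

(** * Coefficients of power series and substitution *)

Section PowerSeries.
Variable R : comNzRingType.

Section Coefficients.
Variable n : nat.
Implicit Types (f g : {mps R[n]}) (m a : 'X_{1..n}).

Lemma mps_coef_sum (I : Type) (s : seq I) (P : pred I) (F : I -> {mps R[n]}) m :
  (\sum_(i <- s | P i) F i) m = \sum_(i <- s | P i) F i m.
Proof. exact: (big_morph (fun f : {mps R[n]} => f m)). Qed.

Lemma mps_coefMn f k m : (f *+ k) m = f m *+ k.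
Proof. by elim: k => [//|k IHk]; rewrite !mulrS mps_coefD IHk. Qed.

Lemma mps_coef_mulXm a f m :
  (mpsXm R a * f) m = if (a <= m)%MM then f (m - a)%MM else 0.
Proof.
rewrite mps_coefM; case: ifP => [le_am | nle_am]; last first.
  rewrite big1 // => k /eqP Em /=; case: eqP => [E|]; last by rewrite mul0r.
  by rewrite Em E lem_addr in nle_am.
have ltm b : (b <= m)%MM -> (mdeg b < (mdeg m).+1)%N.
  by move=> le_bm; rewrite ltnS -(submK le_bm) mdegD leq_addl.
rewrite (bigD1 (BMultinom (ltm _ le_am), BMultinom (ltm _ (lem_subr m a)))) /=.
  rewrite eqxx mul1r big1 ?addr0 // => -[k1 k2] /= /andP[/eqP Em nek].
  case: eqP => [E|]; last by rewrite mul0r.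
  case/eqP: nek; congr (_, _); apply: val_inj => //=.
  by rewrite -E -{1}(addmK k1 k2) addmC -Em.
by rewrite addmC submK.
Qed.

Lemma mps_coef_mulX i f m :
  (mpsX R i * f) m = if m i == 0%N then 0 else f (m - U_(i))%MM.
Proof.
rewrite mps_coef_mulXm; suff -> : (U_(i) <= m)%MM = (m i != 0%N) by case: eqP.
rewrite -lt0n; apply/mnm_lepP/idP => [/(_ i)|mi j]; first by rewrite mnm1E eqxx.
by rewrite mnm1E; case: eqP => [<-|].
Qed.

Lemma mpsXmD a b : mpsXm R (a + b)%MM = mpsXm R a * mpsXm R b.
Proof.
apply/mpsP => m; rewrite mps_coef_mulXm /=; case: ifP => [le_am | nle_am].
  by rewrite -{1}(submK le_am) addmC eqm_add2l.
by case: eqP nle_am => // ->; rewrite lem_addr.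
Qed.

Lemma mpsXm0 : mpsXm R (0%MM : 'X_{1..n}) = 1. Proof. by []. Qed.

Lemma mps_coef_eqM d (f f' g g' : {mps R[n]}) :
    (forall m, (mdeg m < d)%N -> f m = f' m) ->
    (forall m, (mdeg m < d)%N -> g m = g' m) ->
  forall m, (mdeg m < d)%N -> (f * g) m = (f' * g') m.
Proof.
move=> eqf eqg m lt_md; rewrite !mps_coefM; apply: eq_bigr => k _.
by rewrite eqf 1?eqg // (leq_trans (bmdeg _)).
Qed.

End Coefficients.

Section Composition.
Variables (n k : nat) (F : 'I_k -> {mps R[n]}).
Hypothesis F0 : forall i, F i 0%MM = 0.
Implicit Types (g h : {mps R[k]}).

Lemma mps_order_prodX (a : 'X_{1..k}) : mps_order_ge (mdeg a) (mmap1 F a).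
Proof.
rewrite mdegE /mmap1; apply: (big_ind2 (fun d f => mps_order_ge d f)).
- exact: mps_order1.
- by move=> d f e f'; apply: mps_orderM.
by move=> i _; apply: mps_orderX.
Qed.

(** Since [F^a] has order at least [|a|], the coefficients of [g(F)] below degree [d] only see those
    of [g] below [d]. Substitution thus inherits its algebraic laws from the ring morphism [mmap];
    [p] is arbitrary from degree [d] on, so that it can be a product of truncations. *)
Lemma mps_comp_mmap g (p : {mpoly R[k]}) d m :
    (forall a, (mdeg a < d)%N -> p@_a = g a) -> (mdeg m < d)%N ->
  mps_comp g F m = mmap (GRing.in_alg {mps R[n]}) F p m.
Proof.
(* [D] covers all of [p]; from degree [d] on, where [p] and [g] may differ, [F^a] has coefficient 0
   at [m]. *)
move=> eqp lt_md; pose D := maxn d (msize p).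
rewrite (mmapE D) ?leq_maxr // mps_coef_sum.
have ordF a : (d <= mdeg a)%N -> mmap1 F a m = 0.
  by move=> le_da; apply/mps_order_prodX/(leq_trans lt_md).
pose s := [seq val x | x : 'X_{1..k < D}].
have coefA (c : R) (f : {mps R[n]}) : (GRing.in_alg {mps R[n]} c * f) m = c * f m.
  by rewrite -[_ * f]/(c%:A * f) mulr_algl.
transitivity (\sum_(a <- s) comp_term g F a m).
  apply: fsum_seq => [|a]; first by rewrite map_inj_uniq ?enum_uniq //; apply: val_inj.
  rewrite mps_coefZ -/(mmap1 F a) => nsa; rewrite ordF ?mulr0 // leqNgt.
  apply: contra nsa => lt_ad; have lt_aD : (mdeg a < D)%N by rewrite leq_max lt_ad.
  by apply/mapP; exists (BMultinom lt_aD); rewrite ?mem_enum.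
rewrite big_image; apply: eq_bigr => a _; rewrite coefA mps_coefZ -/(mmap1 F a).
by have [/eqp->//|/ordF->] := ltnP (mdeg a) d; rewrite !mulr0.
Qed.

Lemma mps_comp_trunc g d m : (mdeg m < d)%N ->
  mps_comp g F m = mmap (GRing.in_alg {mps R[n]}) F (mps_trunc d g) m.
Proof. by move=> lt_md; apply: mps_comp_mmap lt_md => a lt_ad; rewrite mcoeff_trunc lt_ad. Qed.

Lemma mps_compM g h : mps_comp (g * h) F = mps_comp g F * mps_comp h F.
Proof.
apply/mpsP => m; set d := (mdeg m).+1; have lt_md : (mdeg m < d)%N by [].
rewrite (@mps_coef_eqM _ d _ _ _ _ (mps_comp_trunc g (d := d))
           (mps_comp_trunc h (d := d)) _ lt_md).
rewrite -rmorphM; apply: mps_comp_mmap lt_md => a lt_ad.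
by rewrite -(mps_mulE _ _ lt_ad).
Qed.

Lemma mps_compD g h : mps_comp (g + h) F = mps_comp g F + mps_comp h F.
Proof.
apply/mpsP => m; set d := (mdeg m).+1; have lt_md : (mdeg m < d)%N by [].
rewrite mps_coefD !(mps_comp_trunc _ lt_md) -mps_coefD -rmorphD.
rewrite -(mps_comp_trunc _ lt_md); apply: mps_comp_mmap lt_md => a lt_ad.
by rewrite mcoeffD !mcoeff_trunc lt_ad.
Qed.

Lemma mps_compC c : mps_comp (c%:A : {mps R[k]}) F = c%:A.
Proof.
apply/mpsP => m; rewrite (@mps_comp_mmap _ c%:MP _ _ _ (ltnSn _)) ?mmapC //.
by move=> a _; rewrite mcoeffC mps_coefZ.
Qed.

Lemma mps_compX i : mps_comp (mpsX R i : {mps R[k]}) F = F i.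
Proof.
apply/mpsP => m; rewrite (@mps_comp_mmap _ 'X_i _ _ _ (ltnSn _)) ?mmapX ?mmap1U //.
by move=> a _; rewrite mcoeffX eq_sym.
Qed.

Lemma mps_comp_sum (I : Type) (s : seq I) (P : pred I) (G : I -> {mps R[k]}) :
  mps_comp (\sum_(i <- s | P i) G i) F = \sum_(i <- s | P i) mps_comp (G i) F.
Proof.
apply: (big_morph (fun g : {mps R[k]} => mps_comp g F) mps_compD).
by have := mps_compC 0; rewrite !scale0r.
Qed.

End Composition.
End PowerSeries.

Lemma mmap1D (S : comNzRingType) (n : nat) (h : 'I_n -> S) (a b : 'X_{1..n}) :
  mmap1 h (a + b)%MM = mmap1 h a * mmap1 h b.
Proof. by rewrite /mmap1 -big_split; apply: eq_bigr => i _; rewrite mnmDE exprD. Qed.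

(** * Monomial expansion of products and determinants; Euler operators *)

Section MonomialExpansion.
Variables (R : comNzRingType) (n : nat).

Lemma mps_coef_sign (c : bool) (f : {mps R[n]}) m : ((-1) ^+ c * f) m = (-1) ^+ c * f m.
Proof. by case: c; rewrite ?expr1 ?expr0 ?mulN1r ?mul1r. Qed.

(** Distributivity for the polynomial truncations. The bound [d] makes the choices of one monomial
    per factor a finite type and loses nothing, since summands of [b] have degree below [d]. *)
Lemma mps_coef_prod (I : finType) (h : I -> {mps R[n]}) d (b : 'X_{1..n}) :
    (mdeg b < d)%N ->
  (\prod_i h i) b =
    \sum_(phi : {ffun I -> 'X_{1..n < d}} | (\sum_i val (phi i))%MM == b)
       \prod_i h i (phi i).
Proof.
move=> lt_bd; transitivity (\prod_i mps_trunc d (h i))@_b.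
  pose K (f : {mps R[n]}) (p : {mpoly R[n]}) :=
    forall m, (mdeg m < d)%N -> f m = p@_m.
  have Ktrunc f : K f (mps_trunc d f) by move=> m lt_md; rewrite mcoeff_trunc lt_md.
  suff: K (\prod_i h i) (\prod_i mps_trunc d (h i)) by apply.
  apply: (big_ind2 K) => [m _|f p g q Kf Kg m lt_md|i _]; last exact: Ktrunc.
    by rewrite mcoeff1.
  rewrite (mps_mulE _ _ lt_md); apply: eq_mcoeffM => k le_km.
    by rewrite -Kf ?Ktrunc // (leq_ltn_trans le_km).
  by rewrite -Kg ?Ktrunc // (leq_ltn_trans le_km).
rewrite /mps_trunc bigA_distr_bigA raddf_sum [RHS]big_mkcond; apply: eq_bigr => phi _.
have XE : \prod_i 'X_[phi i] = 'X_[(\sum_i val (phi i))%MM] :> {mpoly R[n]}.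
  by rewrite (big_morph _ (@mpolyXD n R) (mpolyX0 n R)).
rewrite scaler_prod XE /=. by rewrite mcoeffZ mcoeffX; case: eqP => _; rewrite ?mulr1 ?mulr0.
Qed.

(** The operator u_j d/du_j, given by its eigenvalues on monomials; this is what makes the
    determinant below numerical on each product of monomials. *)
Definition mps_euler (j : 'I_n) (f : {mps R[n]}) : {mps R[n]} := MPS (fun m => f m *+ m j).

Lemma mps_eulerE j f : mps_euler j f = mpsX R j * mps_deriv j f.
Proof.
apply/mpsP => m; rewrite mps_coef_mulX /=.
have [->|mj] := eqVneq (m j) 0%N; first by rewrite mulr0n.
have le_jm : (U_(j) <= m)%MM.
  by apply/mnm_lepP => k; rewrite mnm1E; case: eqP => // <-; rewrite lt0n.
by rewrite submK // mnmBE mnm1E eqxx subn1 prednK // lt0n.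
Qed.

Lemma mps_eulerM j f g : mps_euler j (f * g) = mps_euler j f * g + f * mps_euler j g.
Proof.
apply/mpsP => m; rewrite mps_coefD !mps_coefM [LHS]/= -sumrMnl -big_split /=.
apply: eq_bigr => k /eqP Em; rewrite mulrnAl mulrnAr -mulrnDr.
by congr (_ *+ _); rewrite [in LHS]Em mnmDE.
Qed.

Lemma mps_euler1 j : mps_euler j 1 = 0.
Proof. by apply/mpsP => m /=; case: eqP => [->|_]; rewrite ?mnm0E ?mul0rn. Qed.

Lemma mps_eulerX j f e : mps_euler j (f ^+ e.+1) = mps_euler j f * f ^+ e *+ e.+1.
Proof.
elim: e => [|e IHe]; first by rewrite expr0 mulr1.
by rewrite exprS mps_eulerM IHe mulrnAr mulrCA -exprS -mulrS.
Qed.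

(** Multiplying [v A = 0] by the adjugate gives [det A] times [v]. As [R] may have zero divisors, a
    coordinate equal to 1 replaces [v != 0]. *)
Lemma det_eq0_kernel (A : 'M[R]_n) (v : 'rV[R]_n) i : v *m A = 0 -> v 0 i = 1 -> \det A = 0.
Proof.
move=> vA0 vi1; have := congr1 (fun B : 'rV_n => (B *m \adj A) 0 i) vA0.
by rewrite /= -mulmxA mul_mx_adj mul0mx mul_mx_scalar !mxE vi1 mulr1.
Qed.

(* On a product of monomials u^(m_i) with sum of the m_i equal to b, the matrix
   below acts as (c_i delta_ij - m_ij), whose rows indexed by the support of b
   sum to zero. *)
Lemma det_euler_coef (h : 'I_n -> {mps R[n]}) (b : 'X_{1..n}) :
    b != 0%MM -> (forall i, b i = 0%N -> h i = 1) ->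
  (\det (\matrix_(i, j) (h i *+ (maxn 1 (b i) * (i == j)) - mps_euler j (h i)))) b = 0.
Proof.
move=> nz_b h1; rewrite /determinant mps_coef_sum.
pose d := (mdeg b).+1; pose w (phi : {ffun 'I_n -> 'X_{1..n < d}}) : 'M[R]_n :=
  \matrix_(i, j) ((maxn 1 (b i) * (i == j))%:R - (val (phi i) j)%:R).
transitivity (\sum_(s : 'S_n)
    \sum_(phi : {ffun 'I_n -> 'X_{1..n < d}} | (\sum_i val (phi i))%MM == b)
       (-1) ^+ s * \prod_i w phi i (s i) * \prod_i h i (phi i)).
  apply: eq_bigr => s _; rewrite mps_coef_sign (mps_coef_prod _ (ltnSn _)) mulr_sumr.
  apply: eq_bigr => phi _; rewrite -mulrA -big_split; congr (_ * _).
  apply: eq_bigr => i _; rewrite /w !mxE mps_coefD mps_coefN mps_coefMn /= mulrBl.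
  by rewrite !mulr_natl.
rewrite exchange_big /= big1 // => phi /eqP sum_phi; rewrite -mulr_suml.
(* Where [b i = 0] the series [h i] is 1, so a nonconstant monomial chosen there has coefficient 0.
   In the remaining case [phi] is trivial off the support of [b]. *)
have [/existsP[i /andP[/eqP bi0 nz_phi]]|] :=
  boolP [exists i, (b i == 0%N) && (val (phi i) != 0%MM)].
  by rewrite (bigD1 i) // h1 //= (negPf nz_phi) !mul0r mulr0.
rewrite negb_exists => /forallP phi0.
have [i nz_bi] : exists i, b i != 0%N.
  apply/existsP; apply: contraR nz_b; rewrite negb_exists => /forallP b0.
  by apply/eqP/mnmP => i; rewrite mnm0E; apply/eqP; rewrite -[_ == _]negbK.
rewrite -[X in X * _]/(\det (w phi)).
(* The left kernel vector is the indicator of the support of [b]: column [j] sums to [b j] minus the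
   total exponent of u_j in [phi], which is [b j]. *)
rewrite (@det_eq0_kernel _ (\row_i (b i != 0%N)%:R) i) ?mul0r ?mxE ?nz_bi //.
apply/rowP => j; rewrite /w !mxE.
transitivity (\sum_k ((b k * (k == j))%:R - (val (phi k) j)%:R) : R); last first.
  rewrite sumrB -!natr_sum -mnm_sumE sum_phi (bigD1 j) //= eqxx muln1 big1 ?addn0 ?subrr //.
  by move=> k /negPf ->; rewrite muln0.
apply: eq_bigr => k _; rewrite !mxE.
have /= := phi0 k; have [bk0|nz_bk] /= := eqVneq (b k) 0%N; last first.
  by move=> _; rewrite mul1r (maxn_idPr _) // lt0n.
by rewrite negbK => /eqP ->; rewrite bk0 mul0r mul0n mnm0E subrr.
Qed.

End MonomialExpansion.

(** * The operator [L] and its compatibility with substitution of [F] *)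

Section Lagrange.
Variables (R : comNzRingType) (n : nat) (G F : 'I_n -> {mps R[n]}).
Hypothesis F0 : forall i, F i 0%MM = 0.
Hypothesis FE : forall i, F i = mpsX R i * mps_comp (G i) F.

(** The operator [L] of the idea above, [mmap1 G b] being [G^b]; the exponent [b] serves both for u
    and for X. *)
Definition lagrange_series (h : {mps R[n]}) : {mps R[n]} := MPS (fun b => (h * mmap1 G b) b).

Lemma lagrangeE h b : lagrange_series h b = (h * mmap1 G b) b. Proof. by []. Qed.

Lemma lagrangeD g h : lagrange_series (g + h) = lagrange_series g + lagrange_series h.
Proof. by apply/mpsP => b; rewrite mps_coefD !lagrangeE -mps_coefD -mulrDl. Qed.

Lemma lagrangeZ c h : lagrange_series (c *: h) = c *: lagrange_series h.
Proof. by apply/mpsP => b; rewrite mps_coefZ !lagrangeE -mps_coefZ scalerAl. Qed.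

Lemma lagrange_sum (I : Type) (s : seq I) (P : pred I) (h : I -> {mps R[n]}) :
  lagrange_series (\sum_(i <- s | P i) h i) = \sum_(i <- s | P i) lagrange_series (h i).
Proof.
apply: (big_morph _ lagrangeD); by apply/mpsP => b; rewrite lagrangeE mul0r.
Qed.

(** At X^b both sides read [u^(b - e_i)] of [h G^b], because [G^b] is [G_i] times [G^(b - e_i)];
    both vanish when [b i = 0]. *)
Lemma lagrange_mulX i h : lagrange_series (mpsX R i * h) = mpsX R i * lagrange_series (G i * h).
Proof.
apply/mpsP => b; rewrite lagrangeE -mulrA !mps_coef_mulX.
case: eqP => // /eqP nz_bi; rewrite lagrangeE; congr (mps_coef _ _).
have {1}-> : b = (U_(i) + (b - U_(i)))%MM.
  rewrite addmC submK //; apply/mnm_lepP => k; rewrite mnm1E.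
  by case: eqP => // <-; rewrite lt0n.
by rewrite mmap1D mmap1U mulrA (mulrC h).
Qed.

Lemma mps_head_tail (h : {mps R[n]}) :
  exists q : 'I_n -> {mps R[n]}, h = (h 0%MM)%:A + \sum_i mpsX R i * q i.
Proof.
(* [sel] assigns to each nonconstant monomial one variable dividing it, so that exactly one [q i]
   receives the monomial. *)
pose sel (m : 'X_{1..n}) := [pick i | m i != 0%N].
exists (fun i => MPS (fun m => if sel (m + U_(i))%MM == Some i then h (m + U_(i))%MM else 0)).
apply/mpsP => m; rewrite mps_coefD mps_coefZ mps_coef_sum mps_coef1.
have coefq i : (mpsX R i *
    MPS (fun m => if sel (m + U_(i))%MM == Some i then h (m + U_(i))%MM else 0)) m
  = if sel m == Some i then h m else 0.
  rewrite mps_coef_mulX /=; case: eqP => [mi0|/eqP nz_mi].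
    by rewrite /sel; case: pickP => // j nz_mj; case: eqP => // -[Eji]; rewrite Eji mi0 in nz_mj.
  rewrite submK //; apply/mnm_lepP => k; rewrite mnm1E.
  by case: eqP => // <-; rewrite lt0n.
under eq_bigr do rewrite coefq.
rewrite /sel; case: pickP => [i nz_mi | m0].
  rewrite (negPf (contraNneq _ nz_mi)) => [|->]; last by rewrite mnm0E.
  rewrite mulr0 add0r (bigD1 i) //= eqxx big1 ?addr0 // => j nji.
  by case: eqP => // -[Eij]; rewrite Eij eqxx in nji.
have -> : m = 0%MM by apply/mnmP => i; rewrite mnm0E; apply/eqP; rewrite -[_ == _]negbK m0.
by rewrite eqxx mulr1 big1 ?addr0.
Qed.

(* By lagrange_mulX, the defect L h - h(F) L 1 is a sum of X_i times defects of
   other series, hence of arbitrarily high order. *)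
Lemma lagrange_comp h : lagrange_series h = mps_comp h F * lagrange_series 1.
Proof.
suff ord d : forall h, mps_order_ge d (lagrange_series h - mps_comp h F * lagrange_series 1).
  by apply/eqP; rewrite -subr_eq0; apply/eqP/mpsP => m; apply: (ord _ _ _ (ltnSn _)).
elim: d => // d IHd {}h m; have [q Eh] := mps_head_tail h.
move: (h 0%MM) Eh => c ->; rewrite ltnS => le_md.
rewrite lagrangeD lagrangeZ mps_compD // mps_compC // mulrDl mulr_algl opprD addrACA subrr add0r.
rewrite lagrange_sum mps_comp_sum // mulr_suml -sumrB mps_coef_sum big1 // => i _.
(* By [F_i = X_i G_i(F)], the defect of [X_i q_i] is [X_i] times the defect of [G_i q_i], which
   gains one order. *)
rewrite lagrange_mulX mps_compM // mps_compX // FE -!mulrA mulrA -mulrA.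
rewrite [mps_comp _ _ * (_ * _)]mulrA -mps_compM // -mulrBr mps_coef_mulX.
case: eqP => // /eqP nz_mi; apply: IHd; apply: leq_trans le_md.
rewrite -[in X in (_ < X)%N](@submK _ U_(i) m) ?mdegD ?mdeg1 ?addn1 //.
by apply/mnm_lepP => k; rewrite mnm1E; case: eqP => // <-; rewrite lt0n.
Qed.

(** What [G_i^e] becomes when [L] absorbs a matrix entry [d - X_i g(F)]. At [e = 0] the second term
    is absent, as a multiple of X_i has no monomial free of X_i. *)
Definition lagrange_factor (i : 'I_n) (d : bool) (g : {mps R[n]}) (e : nat) : {mps R[n]} :=
  G i ^+ e *+ d - mpsX R i * (if e is k.+1 then g * G i ^+ k else 0).

(** By [lagrange_comp], [X_i g(F) L h = X_i L(g h)], and extracting X^b from it trades one factor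
    [G_i] for [u_i g]. The indices in [s] being distinct, each power [G_i^(b i)] is altered at most
    once. *)
Lemma lagrange_prod (s : seq 'I_n) (d : 'I_n -> bool) (g : 'I_n -> {mps R[n]}) h b :
    uniq s ->
  (\prod_(i <- s) ((d i)%:R - mpsX R i * mps_comp (g i) F) * lagrange_series h) b =
  (h * \prod_(i <- s) lagrange_factor i (d i) (g i) (b i)
     * \prod_(i | i \notin s) G i ^+ b i) b.
Proof.
elim: s h b => [|i s IHs] h b; first by rewrite !big_nil mul1r mulr1.
case/andP=> nsi us; rewrite !big_cons -mulrA mulrBl mps_coefD mps_coefN.
have splitG c : \prod_(j | j \notin s) G j ^+ c j =
    G i ^+ c i * \prod_(j | j \notin i :: s) G j ^+ c j.
  by rewrite (bigD1 i) //; congr (_ * _); apply: eq_bigl => j; rewrite inE negb_or andbC.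
set P := \prod_(j <- s) (_ - _).
have IHP f c : (P * lagrange_series f) c = _ := IHs f c us.
clearbody P.
have -> : mpsX R i * mps_comp (g i) F * (P * lagrange_series h) =
    mpsX R i * (P * lagrange_series (g i * h)).
  rewrite (lagrange_comp h) (lagrange_comp (g i * h)) mps_compM // -!mulrA.
  by congr (_ * _); rewrite mulrCA.
rewrite mulr_natl mps_coefMn mps_coef_mulX IHP.
rewrite {2}/lagrange_factor mulrBl mulrBr mulrBl mps_coefD mps_coefN; congr (_ - _).
  rewrite splitG -mps_coefMn mulrnAl mulrnAr mulrnAl; congr (mps_coef _ _).
  by congr (_ *+ _); rewrite !mulrA; congr (_ * _); rewrite -!mulrA; congr (_ * _); rewrite mulrC.
rewrite -!mulrA [h * _]mulrCA mps_coef_mulX.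
case: ifP => // /negbT nz_bi; rewrite IHP splitG mnmBE mnm1E eqxx subn1.
case Ebi: (b i) nz_bi => [//|k] _.
have Eb j : j != i -> (b - U_(i))%MM j = b j.
  by move=> nji; rewrite mnmBE mnm1E eq_sym (negPf nji) subn0.
rewrite (eq_big_seq (fun j => lagrange_factor j (d j) (g j) (b j))) => [|j sj]; last first.
  by rewrite Eb //; apply: contraNneq nsi => <-.
rewrite [X in _ * (_ * X)](eq_bigr (fun j => G j ^+ b j)) => [|j]; last first.
  by rewrite inE negb_or => /andP[nji _]; rewrite Eb.
congr (mps_coef _ _); rewrite !mulrA; congr (_ * _); rewrite [h * g i]mulrC -!mulrA.
by congr (_ * (_ * _)); rewrite mulrC.
Qed.

(** Each product in Leibniz's formula has one entry per row, so [lagrange_prod] applies with [s]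
    listing all indices. *)
Lemma det_lagrange b :
  (\det (1%:M - XdG G F) * lagrange_series 1) b =
  (\det (\matrix_(i, j) lagrange_factor i (i == j) (mps_deriv j (G i)) (b i))) b.
Proof.
rewrite /determinant mulr_suml !mps_coef_sum; apply: eq_bigr => s _.
rewrite -mulrA !mps_coef_sign; congr (_ * _).
under eq_bigr do rewrite !mxE; under [in RHS]eq_bigr do rewrite mxE.
rewrite (lagrange_prod (fun i => i == s i) (fun i => mps_deriv (s i) (G i))) ?index_enum_uniq //.
by rewrite [X in _ * X]big1 ?mulr1 ?mul1r // => i; rewrite mem_index_enum.
Qed.

End Lagrange.

(* Conjugation by diag(u), with u not assumed invertible. *)
Lemma det_diag_swap (S : comNzRingType) (n : nat) (a u : 'I_n -> S) (B : 'M[S]_n) :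
  \det (\matrix_(i, j) (a i *+ (i == j) - u i * B i j)) =
  \det (\matrix_(i, j) (a i *+ (i == j) - u j * B i j)).
Proof.
apply: eq_bigr => s _; congr (_ * _).
(* Off the fixed points of [s] only the terms in [u] remain, and [s] permutes these points, so the
   products of [u i] and of [u (s i)] agree. *)
rewrite (bigID (fun i => i == s i)) [RHS](bigID (fun i => i == s i)) /=.
congr (_ * _); first by apply: eq_bigr => i /eqP Ei; rewrite !mxE -Ei.
transitivity (\prod_(i | i != s i) u i * \prod_(i | i != s i) - B i (s i)).
  by rewrite -big_split; apply: eq_bigr => i /negPf ni; rewrite !mxE ni mulr0n sub0r /= mulrN.
rewrite (reindex_inj (@perm_inj _ s)) /=.
under eq_bigl => i do rewrite (inj_eq (@perm_inj _ s)).
by rewrite -big_split; apply: eq_bigr => i /negPf ni; rewrite !mxE ni mulr0n sub0r /= mulrN.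
Qed.

(** * The determinant is inverse to [L 1] over a Q-algebra *)

Section LagrangeRat.
Variables (R : comAlgType rat) (n : nat) (G F : 'I_n -> {mps R[n]}).
Hypothesis F0 : forall i, F i 0%MM = 0.
Hypothesis FE : forall i, F i = mpsX R i * mps_comp (G i) F.

Lemma mulrn_eq0_rat (x : R) k : (0 < k)%N -> x *+ k = 0 -> x = 0.
Proof.
move=> k0 xk; have nzk : k%:R != 0 :> rat by rewrite pnatr_eq0 -lt0n.
by rewrite -[x]scale1r -(mulVf nzk) -scalerA scaler_nat xk scaler0.
Qed.

Theorem det_lagrange1 : \det (1%:M - XdG G F) * lagrange_series G 1 = 1.
Proof.
apply/mpsP => b; rewrite det_lagrange // mps_coef1.
have [-> | nz_b] := eqVneq b 0%MM.
  rewrite (_ : \matrix_(i, j) _ = 1%:M) ?det1 ?mps_coef1 ?eqxx //.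
  by apply/matrixP => i j; rewrite !mxE mnm0E /lagrange_factor expr0 [X in _ - X]mulr0 subr0.
pose B : 'M[{mps R[n]}]_n := \matrix_(i, j)
  (if b i is k.+1 then mps_deriv j (G i) * G i ^+ k else 0).
have -> : \matrix_(i, j) lagrange_factor G i (i == j) (mps_deriv j (G i)) (b i) =
    \matrix_(i, j) (G i ^+ b i *+ (i == j) - mpsX R i * B i j).
  by apply/matrixP => i j; rewrite !mxE.
(* The swap turns u_i d_j G_i into u_j d_j G_i, so that Euler operators appear. *)
rewrite (det_diag_swap (fun i => G i ^+ b i)); set N := (X in \det X).
(* Row [i] is scaled by max(1, b_i) rather than b_i, so that the total factor is a positive integer,
   cancellable because [R] contains Q. *)
apply: (@mulrn_eq0_rat _ (\prod_i maxn 1 (b i))).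
  by rewrite prodn_gt0 // => i; rewrite leq_maxl.
have := @det_euler_coef _ _ (fun i => G i ^+ b i) b nz_b.
(* The Euler operator sends [G_i^(b i)] to [b i] times u_j d_j G_i [G_i^(b i - 1)]; for [b i = 0]
   the row is that of the identity. *)
rewrite (_ : \matrix_(i, j) _ = diag_mx (\row_i (maxn 1 (b i))%:R) *m N); last first.
  apply/matrixP => i j; rewrite mul_diag_mx !mxE mulr_natl mulrnBl -mulrnA mulnC.
  congr (_ - _); case: (b i) => [|k].
    by rewrite expr0 mulr0 mul0rn mps_euler1.
  by rewrite mps_eulerX mps_eulerE mulrA (maxn_idPr _).
rewrite det_mulmx det_diag; under eq_bigr do rewrite mxE.
rewrite -natr_prod mulr_natl mps_coefMn; apply=> i ->.
by rewrite expr0.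
Qed.

End LagrangeRat.

(** * Exponents in the three groups of variables ubar, u and X *)

Section Embedding.
Variables (R : comNzRingType) (n N : nat) (f : 'I_n -> 'I_N).

Definition mnm_emb (a : 'X_{1..n}) : 'X_{1..N} := (\sum_i U_(f i) *+ a i)%MM.

Lemma mnm_embE a x : mnm_emb a x = (\sum_i (f i == x) * a i)%N.
Proof. by rewrite mnm_sumE; apply: eq_bigr => i _; rewrite mulmnE mnm1E. Qed.

Lemma mnm_emb_in a i : injective f -> mnm_emb a (f i) = a i.
Proof.
move=> injf; rewrite mnm_embE (bigD1 i) //= eqxx mul1n big1 ?addn0 // => j /negPf nji.
by rewrite (inj_eq injf) nji.
Qed.

Lemma mnm_emb_out a x : (forall i, f i != x) -> mnm_emb a x = 0%N.
Proof. by move=> nfx; rewrite mnm_embE big1 // => i _; rewrite (negPf (nfx i)). Qed.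

Lemma mnm_emb0 : mnm_emb 0%MM = 0%MM.
Proof. by apply/mnmP => x; rewrite mnm_embE mnm0E big1 // => i _; rewrite mnm0E muln0. Qed.

Lemma mnm_embD a b : mnm_emb (a + b)%MM = (mnm_emb a + mnm_emb b)%MM.
Proof.
apply/mnmP => x; rewrite mnmDE !mnm_embE -big_split; apply: eq_bigr => i _.
by rewrite mnmDE mulnDr.
Qed.

Lemma mnm_emb1 i : mnm_emb U_(i)%MM = U_(f i)%MM.
Proof.
apply/mnmP => x; rewrite mnm_embE mnm1E (bigD1 i) //= mnm1E eqxx muln1 big1 ?addn0 //.
by move=> j nji; rewrite mnm1E [i == j]eq_sym (negPf nji) muln0.
Qed.

Lemma mmap1_mpsX a : mmap1 (fun i => mpsX R (f i)) a = mpsXm R (mnm_emb a).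
Proof.
rewrite /mnm_emb (big_morph _ (@mpsXmD R N) (@mpsXm0 R N)); apply: eq_bigr => i _.
by elim: (a i) => [|k IHk]; rewrite ?mulm0n ?expr0 // mulmS exprS mpsXmD IHk.
Qed.

Lemma prod_mpsX (k : nat) (w : 'I_k -> 'I_n) :
  \prod_j mpsX R (f (w j)) = mpsXm R (mnm_emb (\sum_j U_(w j))%MM).
Proof.
rewrite (big_morph _ mnm_embD mnm_emb0) (big_morph _ (@mpsXmD R N) (@mpsXm0 R N)).
by apply: eq_bigr => j _; rewrite mnm_emb1.
Qed.

End Embedding.

Section Glue.
Variable n : nat.
Implicit Types (a b c : 'X_{1..n}) (m : 'X_{1..n + n + n}).

Lemma ubar_idx_inj : injective (@ubar_idx n).
Proof. by move=> i j /lshift_inj /lshift_inj. Qed.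
Lemma u_idx_inj : injective (@u_idx n).
Proof. by move=> i j /lshift_inj /rshift_inj. Qed.
Lemma X_idx_inj : injective (@X_idx n).
Proof. by move=> i j /rshift_inj. Qed.

Definition mnm_glue a b c : 'X_{1..n + n + n} :=
  (mnm_emb (@ubar_idx n) a + mnm_emb (@u_idx n) b + mnm_emb (@X_idx n) c)%MM.

Lemma ubar_part_glue a b c : ubar_part (mnm_glue a b c) = a.
Proof.
apply/mnmP => i; rewrite mnmE !mnmDE mnm_emb_in; last exact: ubar_idx_inj.
by rewrite !mnm_emb_out ?addn0 // => j; rewrite /X_idx /u_idx /ubar_idx !eq_shift.
Qed.

Lemma u_part_glue a b c : u_part (mnm_glue a b c) = b.
Proof.
apply/mnmP => i; rewrite mnmE !mnmDE (mnm_emb_in b); last exact: u_idx_inj.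
by rewrite !mnm_emb_out ?addn0 // => j; rewrite /X_idx /u_idx /ubar_idx !eq_shift.
Qed.

Lemma X_part_glue a b c : X_part (mnm_glue a b c) = c.
Proof.
apply/mnmP => i; rewrite mnmE !mnmDE (mnm_emb_in c); last exact: X_idx_inj.
by rewrite !mnm_emb_out ?addn0 // => j; rewrite /X_idx /u_idx /ubar_idx !eq_shift.
Qed.

Lemma mnm_part_inj m m' :
  ubar_part m = ubar_part m' -> u_part m = u_part m' -> X_part m = X_part m' -> m = m'.
Proof.
move=> E1 E2 E3; apply/mnmP => x; case: (split_ordP x) => [y|i] ->.
  case: (split_ordP y) => [i|i] ->.
    by move/mnmP/(_ i): E1; rewrite !mnmE.
  by move/mnmP/(_ i): E2; rewrite !mnmE.
by move/mnmP/(_ i): E3; rewrite !mnmE.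
Qed.

Lemma mnm_partK m : mnm_glue (ubar_part m) (u_part m) (X_part m) = m.
Proof. by apply: mnm_part_inj; rewrite ?ubar_part_glue ?u_part_glue ?X_part_glue. Qed.

Lemma ubar_partD m m' : ubar_part (m + m')%MM = (ubar_part m + ubar_part m')%MM.
Proof. by apply/mnmP => i; rewrite !mnmE. Qed.
Lemma u_partD m m' : u_part (m + m')%MM = (u_part m + u_part m')%MM.
Proof. by apply/mnmP => i; rewrite !mnmE. Qed.
Lemma X_partD m m' : X_part (m + m')%MM = (X_part m + X_part m')%MM.
Proof. by apply/mnmP => i; rewrite !mnmE. Qed.

End Glue.

(** * Words, letter counts and Gaussian moments *)

Section Words.
Variables (n k : nat).

Lemma word_typeE (w : 'I_k -> 'I_n) i : (\sum_j U_(w j))%MM i = #|[set j | w j == i]|.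
Proof.
rewrite mnm_sumE -sum1_card [RHS]big_mkcond; apply: eq_bigr => j _.
by rewrite inE mnm1E; case: eqP.
Qed.

Lemma word_type_perm (w t : 'I_k -> 'I_n) :
  (\sum_j U_(w j))%MM = (\sum_j U_(t j))%MM -> exists p : 'S_k, forall j, w j = t (p j).
Proof.
move=> Ewt; have /tuple_permP[p Ep] : perm_eq [tuple w j | j < k] [tuple t j | j < k].
  have countE (v : 'I_k -> 'I_n) i : count_mem i [tuple v j | j < k] = (\sum_j U_(v j))%MM i.
    rewrite word_typeE -sum1_count -sum1_card big_map big_enum_cond /=.
    by apply: eq_bigl => j; rewrite inE.
  by apply/allP => i _ /=; rewrite !countE Ewt.
exists p => j; have /val_inj /(congr1 (fun u => tnth u j)) := Ep.
by rewrite !tnth_mktuple.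
Qed.

End Words.

Section Moments.
Variables (R : comNzRingType) (n : nat).
Implicit Types a b : 'X_{1..n}.

Lemma multi_idx_type a : (\sum_j U_(multi_idx (a := a) j))%MM = a.
Proof. by apply/mnmP => i; rewrite word_typeE card_multi_idx. Qed.

(** A bijection with nonzero product matches equal letters, which forces equal letter counts. *)
Lemma gauss_moment_neq a b : a != b -> gauss_moment R a b = 0.
Proof.
move=> neq_ab; apply: big1 => s /is_bijP bij_s; apply/eqP; apply: contraR neq_ab => nz.
have idx_s j : multi_idx (s j) = multi_idx j.
  apply/eqP; apply: contraR nz => /negPf nj.
  by rewrite (bigD1 j) //= nj mul0r.
rewrite -(multi_idx_type a) -(multi_idx_type b); apply/eqP.
rewrite [RHS](reindex s) /=; last exact: onW_bij.
by apply: eq_bigr => j _; rewrite idx_s.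
Qed.

Lemma gauss_moment_perm a : gauss_moment R a a =
  \sum_(s : 'S_(mdeg a)) \prod_j (multi_idx (s j) == multi_idx j)%:R.
Proof.
(* The default value of [insubd] is never reached, the functions summed over being injective. *)
rewrite /gauss_moment (reindex_onto (@pval _) (fun s => insubd (1%g : 'S_(mdeg a)) s)) /=.
  apply: eq_big => [s|s _]; last by apply: eq_bigr => j _; rewrite pvalE.
  rewrite valKd eqxx andbT; apply/is_bijP; rewrite pvalE.
  by exists (s^-1)%g => j; rewrite ?permK ?permKV.
by move=> s /andP[inj_s _]; rewrite insubdK.
Qed.

(* Double counting of the pairs (s, w) where w is the word multi_idx \o s. *)
Lemma gauss_momentE a :
  #|[set w : {ffun 'I_(mdeg a) -> 'I_n} | (\sum_j U_(w j))%MM == a]|%:R * gauss_moment R a a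
  = (mdeg a)`!%:R.
Proof.
set W := [set w : {ffun _} | _].
transitivity (\sum_(w in W) \sum_(s : 'S_(mdeg a))
    \prod_j (multi_idx (s j) == w j)%:R : R).
  rewrite mulr_natl -sumr_const; apply: eq_bigr => w; rewrite inE => /eqP Ew.
  (* [w] rearranges [multi_idx]; translating [s] by [p] shows that the inner sum is the moment,
     whatever [w]. *)
  have [p Ep] : exists p : 'S_(mdeg a), forall j, w j = multi_idx (p j).
    by apply: word_type_perm; rewrite Ew multi_idx_type.
  rewrite gauss_moment_perm [RHS](reindex_inj (mulgI p)); apply: eq_bigr => s _.
  rewrite (reindex_inj (@perm_inj _ p)); apply: eq_bigr => j _.
  by rewrite permM Ep.
rewrite exchange_big /= -card_Sn -sum1_card natr_sum; apply: eq_bigr => s _.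
(* For fixed [s] exactly one word contributes, so the total is the number of permutations. *)
pose ws : {ffun _} := [ffun j => multi_idx (s j)].
have Wws : ws \in W.
  rewrite inE; apply/eqP; rewrite -[RHS]multi_idx_type [RHS](reindex_inj (@perm_inj _ s)).
  by apply: eq_bigr => j _; rewrite ffunE.
rewrite (bigD1 ws) //= [X in _ + X]big1 => [|w /andP[_ nws]].
  by rewrite addr0 big1 // => j _; rewrite ffunE eqxx.
have [j nj] : exists j, multi_idx (s j) != w j.
  apply/existsP; apply: contraR nws; rewrite negb_exists => /forallP E.
  by apply/eqP/ffunP => j; rewrite ffunE; apply/eqP; rewrite eq_sym -[_ == _]negbK.
by rewrite (bigD1 j) //= (negPf nj) mul0r.
Qed.

End Moments.

(** * Powers of ubar X G(u) *)

Section Exponent.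
Variables (R : comNzRingType) (n : nat) (G : 'I_n -> {mps R[n]}).
Implicit Types (h : {mps R[n]}) (m : 'X_{1..n + n + n}) (a : 'X_{1..n}).

Lemma mps_comp_u h m : mps_comp h (fun j => mpsX R (u_idx j)) m =
  if (ubar_part m == 0%MM) && (X_part m == 0%MM) then h (u_part m) else 0.
Proof.
transitivity (h (u_part m) * (m == mnm_glue 0 (u_part m) 0)%:R).
  pose t a := comp_term h (fun j => mpsX R (u_idx j)) a m.
  have tE a : t a = h a * (m == mnm_glue 0 a 0)%:R.
    rewrite /t mps_coefZ -/(mmap1 (fun j => mpsX R (u_idx j)) a) mmap1_mpsX.
    by rewrite /mnm_glue !mnm_emb0 add0m addm0.
  rewrite -tE -[RHS](big_seq1 +%R (u_part m) t).
  apply: (@fsum_seq _ _ [:: u_part m] t) => // a; rewrite inE tE => na.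
  by case: eqP => [E|_]; rewrite ?mulr0 //; rewrite E u_part_glue eqxx in na.
have -> : (m == mnm_glue 0 (u_part m) 0) = (ubar_part m == 0%MM) && (X_part m == 0%MM).
  apply/eqP/andP => [->|[/eqP E1 /eqP E2]]; first by rewrite ubar_part_glue X_part_glue.
  by rewrite -{1}[m]mnm_partK E1 E2.
by case: (_ && _); rewrite ?mulr1 ?mulr0.
Qed.

Lemma mps_coef_diag a h m :
  (mpsXm R (mnm_glue a 0 a) * mps_comp h (fun j => mpsX R (u_idx j))) m =
  if (ubar_part m == a) && (X_part m == a) then h (u_part m) else 0.
Proof.
rewrite mps_coef_mulXm; case: ifP => [le_am | nle_am].
  rewrite -[in RHS](submK le_am) mps_comp_u; set m' := (m - _)%MM.
  rewrite ubar_partD u_partD X_partD ubar_part_glue u_part_glue X_part_glue addm0.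
  have addmE b : (b + a == a)%MM = (b == 0%MM) by rewrite -{2}(add0m a) eqm_add2r.
  by rewrite !addmE.
case: ifP => // /andP[/eqP E1 /eqP E2]; case/negP: nle_am.
rewrite -[m]mnm_partK E1 E2; apply/mnm_lepP => x.
by rewrite !mnmDE mnm_emb0 mnm0E addn0 leq_add2r leq_addr.
Qed.

(** Expand the power over words of length [k]: a word with letter counts [a] gives ubar^a X^a
    [G^a(u)], whence the number of such words as multiplicity. *)
Lemma ubarXG_exp k m : (ubarXG G ^+ k) m =
  if X_part m == ubar_part m then
    mmap1 G (ubar_part m) (u_part m) *+
      #|[set w : {ffun 'I_k -> 'I_n} | (\sum_j U_(w j))%MM == ubar_part m]|
  else 0.
Proof.
pose E h := mps_comp h (fun j => mpsX R (u_idx j)).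
have X0 (j : 'I_n) : mpsX R (u_idx j) 0%MM = 0 :> R.
  by rewrite /=; case: eqP => // /mnmP/(_ (u_idx j)); rewrite mnm0E mnm1E eqxx.
have -> : ubarXG G ^+ k = \sum_(w : {ffun 'I_k -> 'I_n})
    mpsXm R (mnm_glue (\sum_j U_(w j)) 0 (\sum_j U_(w j))) * E (mmap1 G (\sum_j U_(w j))%MM).
  rewrite -[k in LHS]card_ord -prodr_const /ubarXG bigA_distr_bigA; apply: eq_bigr => w _.
  rewrite !big_split /= !prod_mpsX -mpsXmD /mnm_glue mnm_emb0 addm0; congr (_ * _).
  rewrite (big_morph (mmap1 G) (mmap1D G) (mmap11 G)).
  rewrite /E (big_morph _ (mps_compM X0) (_ : _ = 1)).
    by apply: eq_bigr => j _; rewrite mmap1U.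
  by have := mps_compC X0 1; rewrite !scale1r.
rewrite mps_coef_sum; under eq_bigr do rewrite mps_coef_diag.
have [->|nX] := eqVneq (X_part m) (ubar_part m).
  rewrite -sumr_const big_mkcond [RHS]big_mkcond /=; apply: eq_bigr => w _.
  by rewrite inE andbb eq_sym; case: eqP => // ->.
rewrite big1 // => w _; case: ifP => // /andP[/eqP E1 /eqP E2].
by rewrite E1 E2 eqxx in nX.
Qed.

End Exponent.

(** * The Gaussian integral evaluated as [L 1] *)

Section GaussianLagrange.
Variables (R : comAlgType rat) (n : nat) (G : 'I_n -> {mps R[n]}).

(** The moment forces the u-exponent to equal the ubar-exponent [a], and only the power [k = |a|]
    contains ubar^a. Its 1/k! cancels the word count times the moment by [gauss_momentE], so the
    moment need not be evaluated as a!. *)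
Lemma mps_exp_ubarXG m : mps_exp (ubarXG G) m * gauss_moment R (ubar_part m) (u_part m) =
  if m == mnm_glue (ubar_part m) (ubar_part m) (ubar_part m)
  then mmap1 G (ubar_part m) (u_part m) else 0.
Proof.
set a := ubar_part m; set c := u_part m.
have -> : (m == mnm_glue a a a) = (X_part m == a) && (c == a).
  apply/eqP/andP => [E|[/eqP E1 /eqP E2]].
    by rewrite /c E X_part_glue u_part_glue !eqxx.
  by rewrite -[m]mnm_partK -/a -/c E1 E2.
have [Eca|neq_ca] := eqVneq c a; last by rewrite gauss_moment_neq 1?eq_sym // mulr0 andbF.
have -> : mps_exp (ubarXG G) m = exp_term (ubarXG G) (mdeg a) m.
  rewrite -[RHS](big_seq1 +%R (mdeg a) (fun k => exp_term (ubarXG G) k m)).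
  apply: (@fsum_seq _ _ [:: mdeg a]) => // k; rewrite inE => nka.
  rewrite mps_coefZ ubarXG_exp -/a; case: eqP => [_|]; last by rewrite mulr0.
  rewrite (_ : [set w | _] = finset.set0) ?cards0 ?mulr0 //.
  apply/setP => w; rewrite !inE; apply: contraNF nka => /eqP <-.
  by rewrite mdeg_sum (eq_bigr (fun=> 1%N)) ?sum1_card ?card_ord // => j _; rewrite mdeg1.
rewrite mps_coefZ ubarXG_exp -/a -/c Eca andbT; case: eqP => [_|]; last by rewrite mulr0 mul0r.
rewrite -mulrA mulrnAl -mulrnAr -[gauss_moment _ _ _ *+ _]mulr_natl gauss_momentE mulrCA.
rewrite -[_%:A * _]scalerAl mul1r.
rewrite -(@scaler_nat rat R (mdeg a)`! 1) scalerA mulVf ?scale1r ?mulr1 //.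
by rewrite pnatr_eq0 -lt0n fact_gt0.
Qed.

(** Only ubar^b u^b X^b contributes to X^b, which yields both integrability and the value of the
    integral. *)
Lemma gauss_termE m b : gauss_term (mps_exp (ubarXG G)) m b =
  if m == mnm_glue b b b then mmap1 G b b else 0.
Proof.
rewrite mps_coefZ mps_exp_ubarXG /=; set a := ubar_part m.
case: (m =P mnm_glue b b b) => [Em | nm].
  by rewrite /a Em ubar_part_glue X_part_glue u_part_glue !eqxx mulr1.
case: ifP => [/eqP Em|_]; last by rewrite mul0r.
rewrite Em X_part_glue; case: eqP => [Eb|]; last by rewrite mulr0.
by rewrite -Eb in Em.
Qed.

Lemma gauss_integrable_ubarXG : gauss_integrable (mps_exp (ubarXG G)).
Proof.
move=> b; apply: (sub_finite_set _ (finite_set1 (mnm_glue b b b))) => m.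
by rewrite /mkset gauss_termE; case: (m =P _) => // _; rewrite eqxx.
Qed.

Lemma gauss_int_ubarXG : gauss_int (mps_exp (ubarXG G)) = lagrange_series G 1.
Proof.
apply/mpsP => b; rewrite lagrangeE mul1r.
pose t m := gauss_term (mps_exp (ubarXG G)) m b.
transitivity (\sum_(m <- [:: mnm_glue b b b]) t m).
  apply: (@fsum_seq _ _ _ t) => // m; rewrite inE /t gauss_termE.
  by case: eqP.
by rewrite big_seq1 /t gauss_termE eqxx.
Qed.

End GaussianLagrange.

Theorem theorem7 (R : comAlgType rat) (n : nat) (n_ge1 : (1 <= n)%N)
    (G F : 'I_n -> {mps R[n]})
    (F_const : forall i, F i 0%MM = 0)
    (F_eq : forall i, F i = mpsX R i * mps_comp (G i) F) :
  [/\ gauss_integrable (mps_exp (ubarXG G)),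
      \det (1%:M - XdG G F) \is a GRing.unit
    & gauss_int (mps_exp (ubarXG G)) = 1 / \det (1%:M - XdG G F)].
Proof.
have detL := det_lagrange1 F_const F_eq.
have det_unit : \det (1%:M - XdG G F) \is a GRing.unit.
  by apply/unitrPr; exists (lagrange_series G 1).
split=> //; first exact: gauss_integrable_ubarXG.
by rewrite gauss_int_ubarXG; apply: (mulrI det_unit); rewrite detL mul1r mulrV.
Qed.
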